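(* For all positive integers $n$ and $a$, and every positive integer $b$, we have $\chi_\ell(K_n \square K_{a,b}) = n+a$ if and only if $b \geq \left(\frac{(n+a-1)!}{(a-1)!}\right)^a$. Equivalently, $f_a(K_n) = \left(\frac{(n+a-1)!}{(a-1)!}\right)^a$ for all $n,a \in \mathbb{N}$.
   Context: $K_n$ is the complete graph on $n$ vertices and $K_{a,b}$ is the complete bipartite graph with partite sets of sizes $a$ and $b$. The Cartesian product $G \square H$ has vertex set $V(G)\times V(H)$, with $(u,v)$ adjacent to $(u',v')$ iff either $u=u'$ and $vv'\in E(H)$, or $v=v'$ and $uu'\in E(G)$. A $k$-assignment $L$ for a graph $G$ assigns to each vertex $v$ a list $L(v)$ of $k$ colors; $G$ is $L$-colorable if it has a proper coloring $f$ with $f(v)\in L(v)$ for all $v$. The list chromatic number $\chi_\ell(G)$ is the least $k$ such that $G$ is $L$-colorable for every $k$-assignment $L$. For a graph $G$ and $a\in\mathbb{N}$, $f_a(G)$ denotes the smallest positive integer $b$ such that $\chi_\ell(G\square K_{a,b}) = \chi_\ell(G)+a$. *)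

(* Defs.v *)
From mathcomp Require Import all_boot finmap.
From mathcomp Require Import boolp.

Set Implicit Arguments.
Unset Strict Implicit.
Unset Printing Implicit Defensive.

Record sgraph := SGraph {
  vertex :> finType;
  adj : rel vertex;
  adj_sym : symmetric adj;
  adj_irr : irreflexive adj }.

Section Complete.
Variable n : nat.

Definition complete_adj : rel 'I_n := fun i j => i != j.

Lemma complete_sym : symmetric complete_adj.
Proof. by move=> i j; rewrite /complete_adj eq_sym. Qed.

Lemma complete_irr : irreflexive complete_adj.
Proof. by move=> i; rewrite /complete_adj eqxx. Qed.

Definition complete_graph : sgraph := SGraph complete_sym complete_irr.

End Complete.

Section CompleteBipartite.
Variables a b : nat.

Definition bipartite_adj : rel ('I_a + 'I_b)%type := fun x y =>
  match x, y with
  | inl _, inr _ | inr _, inl _ => true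
  | _, _ => false
  end.

Lemma bipartite_sym : symmetric bipartite_adj.
Proof. by case=> [i|i] [j|j]. Qed.

Lemma bipartite_irr : irreflexive bipartite_adj.
Proof. by case. Qed.

Definition complete_bipartite : sgraph := SGraph bipartite_sym bipartite_irr.

End CompleteBipartite.

Section CartesianProduct.
Variables G H : sgraph.

Definition cart_adj : rel (G * H)%type := fun p q =>
  ((p.1 == q.1) && adj p.2 q.2) || ((p.2 == q.2) && adj p.1 q.1).

Lemma cart_sym : symmetric cart_adj.
Proof.
move=> p q; rewrite /cart_adj (eq_sym p.1) (eq_sym p.2).
by rewrite (adj_sym p.1) (adj_sym p.2).
Qed.

Lemma cart_irr : irreflexive cart_adj.
Proof. by move=> p; rewrite /cart_adj !adj_irr !andbF. Qed.

Definition cart_prod : sgraph := SGraph cart_sym cart_irr.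

End CartesianProduct.

Section ListColoring.
Local Open Scope fset_scope.
Variable G : sgraph.

Definition proper_coloring (C : eqType) (f : G -> C) : Prop :=
  forall u v : G, adj u v -> f u != f v.

Definition list_colorable (C : choiceType) (L : G -> {fset C}) : Prop :=
  exists f : G -> C, (forall v, f v \in L v) /\ proper_coloring f.

Definition k_assignment (k : nat) (C : choiceType) (L : G -> {fset C}) : Prop :=
  forall v, #|` L v| = k.

Definition choosable (k : nat) : Prop :=
  forall (C : choiceType) (L : G -> {fset C}),
    k_assignment k L -> list_colorable L.

Lemma choosable_card : choosable #|G|.
Proof.
move=> C L Lk.
have L0 v : exists c, c \in L v.
  by apply/fset0Pn; rewrite -cardfs_gt0 Lk; apply/card_gt0P; exists v.
have greedy (s : seq G) : uniq s ->
    exists f : G -> C, (forall v, f v \in L v) /\ {in s &, injective f}.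
  elim: s => [_|x s IHs /= /andP[xs us]].
    exists (fun v => xchoose (L0 v)); split=> // v; exact: xchooseP.
  have [f [fL f_inj]] := IHs us.
  have [c cL cs] : exists2 c, c \in L x & c \notin map f s.
    apply: contrapT => Nc.
    have /fsubset_leq_card : L x `<=` [fset c in map f s].
      apply/fsubsetP => c cL; rewrite !inE; apply: contrapT => /negP cs.
      by apply: Nc; exists c.
    rewrite Lk leqNgt => /negP; apply; apply: leq_ltn_trans (_ : size s < _)%N.
      by rewrite card_fseq -(size_map f); exact: size_undup.
    change (size (x :: s) <= #|G|)%N.
    have /card_uniqP <- : uniq (x :: s) by rewrite /= xs.
    exact: max_card.
  exists (fun v => if v == x then c else f v); split=> [v|u v].
    by case: eqP => [->|].
  rewrite !inE; case: (eqVneq u x) => [->|_] /=; case: (eqVneq v x) => [->|_] //=.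
  - by move=> _ vs cE; move: cs; rewrite cE map_f.
  - by move=> us' _ cE; move: cs; rewrite -cE map_f.
  - exact: f_inj.
have [f [fL f_inj]] := greedy _ (enum_uniq G).
exists f; split=> // u v uv; apply/eqP => /(f_inj _ _ (mem_enum _ _) (mem_enum _ _)) uvE.
by move: uv; rewrite uvE adj_irr.
Qed.

Lemma ex_choosable : exists k, `[< choosable k >].
Proof. by exists #|G|; apply/asboolP; exact: choosable_card. Qed.

Definition list_chromatic_number : nat := ex_minn ex_choosable.

End ListColoring.

Definition attains_max (G : sgraph) (a b : nat) : bool :=
  (0 < b) &&
  (list_chromatic_number (cart_prod G (complete_bipartite a b)) ==
     list_chromatic_number G + a).

(* The value 0 is returned only when no such b exists, so f_list a G is a
   positive integer m iff m is the least such b. *)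
Definition f_list (a : nat) (G : sgraph) : nat :=
  match pselect (exists b, attains_max G a b) with
  | left ex_b => ex_minn ex_b
  | right _ => 0
  end.

(* Main.v *)
Require Import Defs.
From mathcomp Require Import all_boot.
From mathcomp Require Import all_order all_algebra finmap ring lra zify.
From mathcomp Require Import boolp.
Import Order.TTheory GRing.Theory Num.Theory.
Set Implicit Arguments.
Unset Strict Implicit.
Unset Printing Implicit Defensive.

(** Put [k = n + a - 1] and call killed by a vertex [j] of the [b] side those
   colourings of the [a] side that do not extend to the copy of [K_n] at [j].
   The residual lists of that copy have at least [n - 1] colours, so they all
   equal one set [B] of [n - 1] colours. If two lists [L(v,i)], [L(v,i')] on the
   [a] side meet, giving both vertices a common colour produces a colouring that
   nothing kills. Otherwise the lists [L(v,i)], for fixed [v], are disjoint, and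
   a killed colouring is determined by [j] and [B]; still, one [j] may kill
   several. So fix two vertices [u <> w] of [K_n], exempt in each [L(w,i)] one
   colour that also lies in some [L(u,i')] with [i' <> i], and keep only the
   colourings in which no other colour of [L(w,i)] used at [(w,i)] is used in
   the fibre of [u]: each [j] kills at most one of these. There are at least
   [(k!/(k-n)!)^a] of them. Indeed, colouring the fibre of [u] uniformly at
   random, let [f_i] be the number of colours then forbidden at [(w,i)]. By AM-GM
   in the form [\prod y_i >= 1 + \sum (1 - 1/y_i)] with
   [y_i = (k - f_i)/(k - 1)], it is enough that [E[1/(k - f_i)] <= 1/(k - 1)].
   Here [f_i] is a sum of independent Bernoulli variables of total mean at most
   [(k - 1)/k]; by convexity the worst case is the binomial [B(k - 1, 1/k)],
   for which the expectation is [(1 - k^-k)/(k - 1)]. *)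

(** * Mean inverse of a constant minus a sum of Bernoulli variables *)

Section MeanInverse.
Local Open Scope ring_scope.
Variable F : realFieldType.

(** The expectation of 1/(m - X), for X a sum of independent Bernoulli variables of means [ps], by
    conditioning on the first. It has this meaning when [size ps < m]: predecessors are truncated
    and the inverse of 0 is 0. *)
Fixpoint mean_inv (ps : seq F) (m : nat) : F :=
  if ps is p :: ps' then (1 - p) * mean_inv ps' m + p * mean_inv ps' m.-1
  else m%:R^-1.

(** Convexity of 1/x at three consecutive positive integers, preserved by averaging over each
    Bernoulli variable. *)
Lemma mean_inv_convex (q : F) R m : 0 <= q <= 1 -> (R + 3 <= m)%N ->
  2 * mean_inv (nseq R q) m.-1 <=
    mean_inv (nseq R q) m + mean_inv (nseq R q) m.-2.
Proof.
move=> /andP[q0 q1]; elim: R m => [|R IH] m mR /=.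
  have [x ->] : exists x, m = x.+3 by exists (m - 3)%N; lia.
  rewrite /=.
  have x0 : 0 <= x%:R :> F by exact: ler0n.
  have -> : x.+3%:R = x%:R + 3 :> F by rewrite -addn3 natrD.
  have -> : x.+2%:R = x%:R + 2 :> F by rewrite -addn2 natrD.
  have -> : x.+1%:R = x%:R + 1 :> F by rewrite -addn1 natrD.
  rewrite -subr_ge0.
  have -> : (x%:R + 3)^-1 + (x%:R + 1)^-1 - 2 * (x%:R + 2)^-1 =
     2 / ((x%:R + 1) * (x%:R + 2) * (x%:R + 3)) :> F.
    by field; rewrite !lt0r_neq0 //; lra.
  by rewrite divr_ge0 // !mulr_ge0 //; lra.
have I1 := IH m ltac:(lia).
have I2 := IH m.-1 ltac:(lia).
have J1 := ler_wpM2l (_ : 0 <= 1 - q) I1.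
have J2 := ler_wpM2l q0 I2.
rewrite subr_ge0 in J1; move: (J1 q1) J2; lra.
Qed.

(** Replacing one variable of mean r q by r variables of mean q does not lower the expectation.
    Averaging the induction hypotheses at m and m - 1 with weights 1 - q and q leaves an error of r
    q^2 times a second difference, nonnegative by convexity. *)
Lemma mean_inv_split (q : F) R r m : 0 <= q <= 1 -> (R + r < m)%N ->
  (1 - r%:R * q) * mean_inv (nseq R q) m + (r%:R * q) * mean_inv (nseq R q) m.-1
    <= mean_inv (nseq (r + R) q) m.
Proof.
move=> q01; have /andP[q0 q1] := q01; elim: r m => [|r IH] m mR.
  by rewrite mul0r subr0 mul1r mul0r addr0.
rewrite addSn /=.
have I1 := IH m ltac:(lia).
have I2 := IH m.-1 ltac:(lia).
have q1' : 0 <= 1 - q by lra.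
have J1 := ler_wpM2l q1' I1.
have J2 := ler_wpM2l q0 I2.
have r0 : 0 <= r%:R :> F by exact: ler0n.
have cvx : 0 <= r%:R * (mean_inv (nseq R q) m + mean_inv (nseq R q) m.-2
   - 2 * mean_inv (nseq R q) m.-1).
  (* For r = 0 the bound on m is too weak for convexity, but the factor r vanishes. *)
  case: (r) mR => [|r'] mR; first by rewrite mul0r.
  by rewrite mulr_ge0 // subr_ge0 mean_inv_convex //; lia.
have J3 := mulr_ge0 (mulr_ge0 q0 q0) cvx.
have -> : r.+1%:R = r%:R + 1 :> F by rewrite -addn1 natrD.
move: J1 J2 J3.
set x := mean_inv _ m; set y := mean_inv _ m.-1; set z := mean_inv _ m.-2.
lra.
Qed.

Lemma mean_inv_le_nseq (q : F) (rs : seq nat) m : 0 <= q <= 1 ->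
    all (fun r : nat => r%:R * q <= 1) rs -> (sumn rs < m)%N ->
  mean_inv [seq r%:R * q | r <- rs] m <= mean_inv (nseq (sumn rs) q) m.
Proof.
move=> q01; have /andP[q0 q1] := q01; elim: rs m => //= r rs IH m /andP[r1 rsq] mR.
have rq0 : 0 <= r%:R * q by rewrite mulr_ge0.
apply: le_trans (mean_inv_split q01 (_ : sumn rs + r < m)%N); last by rewrite addnC.
apply: lerD; first by rewrite ler_wpM2l ?subr_ge0 // IH //; lia.
case: r mR {r1} rq0 => [|r] mR rq0; first by rewrite !mul0r.
by rewrite ler_wpM2l // IH //; lia.
Qed.

(* With [X] binomial [B(R, q)]: write [m / (m - X) = 1 + X / (m - X)] and absorb
   [X] by [f C(R,f) = R C(R-1,f-1)]. *)
Lemma mean_inv_absorb (q : F) R m : (R < m)%N ->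
  m%:R * mean_inv (nseq R q) m =
    1 + R%:R * q * mean_inv (nseq R.-1 q) m.-1.
Proof.
elim: R m => [|R IH] m mR.
  by rewrite !mul0r addr0 mulfV // pnatr_eq0; lia.
have mE : m%:R = m.-1%:R + 1 :> F by rewrite natr1; congr _%:R; lia.
have I1 := IH m ltac:(lia).
have I2 := IH m.-1 ltac:(lia).
have RE : R%:R * mean_inv (nseq R q) m.-1 = R%:R * ((1 - q) * mean_inv (nseq R.-1 q) m.-1 +
  q * mean_inv (nseq R.-1 q) m.-2) by case: (R) => [|R']; rewrite ?mul0r.
rewrite [LHS]/= [X in X%:R * q * _]/= [R.+1.-1]/=.
transitivity ((1 - q) * (m%:R * mean_inv (nseq R q) m)
   + q * (m.-1%:R * mean_inv (nseq R q) m.-1) + q * mean_inv (nseq R q) m.-1).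
  by rewrite /= mE; ring.
rewrite I1 I2 -(natr1 R) -[RHS]addr0.
move: RE => /(congr1 ( *%R q)).
set x := mean_inv (nseq R q) m.-1; set y := mean_inv _ m.-1; set z := mean_inv _ m.-2.
lra.
Qed.

Lemma mean_inv_antimono (q : F) R m : 0 <= q <= 1 -> (R.+1 < m)%N ->
  mean_inv (nseq R q) m <= mean_inv (nseq R q) m.-1.
Proof.
move=> /andP[q0 q1]; elim: R m => [|R IH] m mR /=.
  by rewrite lef_pV2 ?posrE ?ltr0n ?ler_nat; lia.
by apply: lerD; rewrite ler_wpM2l ?subr_ge0 // IH //; lia.
Qed.

Lemma mean_inv_mono (q : F) R R' m : 0 <= q <= 1 -> (R <= R' < m)%N ->
  mean_inv (nseq R q) m <= mean_inv (nseq R' q) m.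
Proof.
move=> q01; elim: R' => [|R' IH]; first by rewrite leqn0 => /andP[/eqP->].
move=> /andP[]; rewrite leq_eqVlt => /orP[/eqP-> //|RR' mR'].
apply: le_trans (IH _) _; first by lia.
have := mean_inv_antimono q01 mR'; move: q01 => /andP[q0 _].
by rewrite -subr_ge0 => /(mulr_ge0 q0) /=; lra.
Qed.

(** At m = R + 1 the absorption identity becomes the recursion S' = 1 + q S of a geometric sum. *)
Lemma mean_inv_binomial (q : F) R :
  R.+1%:R * mean_inv (nseq R q) R.+1 = \sum_(i < R.+1) q ^+ i.
Proof.
elim: R => [|R IH]; first by rewrite big_ord1 /= mul1r invr1.
rewrite mean_inv_absorb // [R.+1.-1]/= [R.+2.-1]/= -mulrA mulrCA IH [RHS]big_ord_recl.
by rewrite mulr_sumr; congr (_ + _); apply: eq_bigr => i _; rewrite exprS.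
Qed.

(** Each variable of mean r/k is split into r variables of mean 1/k, their number is raised to k -
    1, and the binomial case is evaluated. *)
Lemma mean_inv_bound k (rs : seq nat) : (1 < k)%N -> (sumn rs < k)%N ->
  mean_inv [seq r%:R / k%:R | r <- rs] k <= (k.-1%:R)^-1 :> F.
Proof.
move=> k1 rsk; have k0 : 0 < k%:R :> F by rewrite ltr0n; lia.
have q01 : 0 <= (k%:R^-1 : F) <= 1.
  by rewrite invr_ge0 ler0n invf_le1 // ler1n; lia.
apply: le_trans (mean_inv_le_nseq q01 _ rsk) _.
  apply/allP => r rrs; rewrite ler_pdivrMr // mul1r ler_nat.
  apply: leq_trans (ltnW rsk); rewrite sumnE.
  by rewrite (big_rem r) //= leq_addr.
apply: le_trans (mean_inv_mono (R' := k.-1) q01 _) _; first by lia.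
rewrite -(ler_pM2l k0); have k_gt0 : (0 < k)%N by lia.
have := mean_inv_binomial (k%:R^-1) k.-1; rewrite !prednK // => ->.
have km1 : 0 < k.-1%:R :> F by rewrite ltr0n; lia.
set S := (X in X <= _).
have geom : k%:R^-1 ^+ k - 1 = (k%:R^-1 - 1) * S := subrX1 _ _.
have kE : k%:R = k.-1%:R + 1 :> F by rewrite natr1 prednK.
have -> : S = (1 - k%:R^-1 ^+ k) * (k%:R / k.-1%:R).
  rewrite -opprB geom kE; field; rewrite -kE !lt0r_neq0 //.
rewrite ler_piMl ?divr_ge0 ?ler0n // gerBl exprn_ge0 //.
by case/andP: q01.
Qed.
End MeanInverse.

(** * AM-GM for inverses, and averages over a product of finite sets *)

Section ProdInverse.
Local Open Scope ring_scope.
Variable F : realFieldType.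

(** AM-GM for the |I| + 1 numbers consisting of s (the left side) and all 1/y_i: they sum to |I| +
    1, so their product is at most 1. A negative s is trivial; [option I] indexes the extra
    number. *)
Lemma prod_ge_sum_inv (I : finType) (y : I -> F) : (forall i, 0 < y i) ->
  1 + \sum_i (1 - (y i)^-1) <= \prod_i y i.
Proof.
move=> y0; set s := 1 + _; have P0 : 0 < \prod_i y i by apply: prodr_gt0.
have [s0|s0] := ltP s 0; first exact: le_trans (ltW s0) (ltW P0).
pose e (o : option I) := if o is Some i then (y i)^-1 else s.
have /= := @leif_AGM F _ predT e _ => /(_ _)[]; first by case=> //= i _; rewrite invr_ge0 ltW.
have sumE (G : option I -> F) : \sum_(o in predT) G o = G None + \sum_i G (Some i).
  rewrite (bigD1 None) //=; congr (_ + _).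
  rewrite (reindex_omap Some id) => [|[]//]; apply: eq_bigl => i /=.
  by rewrite eqxx.
have prodE (G : option I -> F) : \prod_(o in predT) G o = G None * \prod_i G (Some i).
  rewrite (bigD1 None) //=; congr (_ * _).
  rewrite (reindex_omap Some id) => [|[]//]; apply: eq_bigl => i /=.
  by rewrite eqxx.
rewrite sumE prodE /= prodfV ler_pdivrMr // => le_e _; apply: le_trans le_e _.
rewrite [#|_|]card_option.
suff -> : s + \sum_i (y i)^-1 = #|I|.+1%:R by rewrite divff ?pnatr_eq0 // expr1n mul1r.
by rewrite /s big_split /= sumrN sumr_const addrA subrK -natr1 addrC.
Qed.

(* Expanding the product as a generating polynomial turns the average of
   [1 / (m - #successes)] into [mean_inv]. *)
Lemma coef_prod_mean_inv (ps : seq F) N m : (size ps < N)%N ->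
  \sum_(j < N) (\prod_(p <- ps) ((1 - p)%:P + p *: 'X))`_j / (m - j)%:R
    = mean_inv ps m.
Proof.
elim: ps N m => [|p ps IH] [|N] m //= psN.
  rewrite big_nil big_ord_recl coef1 eqxx div1r subn0 big1 ?addr0 // => i _.
  by rewrite coef1 mul0r.
rewrite big_cons -(IH N.+1) ?(ltnW psN) // -(IH N) //.
set P := \prod_(_ <- ps) _.
transitivity (\sum_(j < N.+1) (1 - p) * (P`_j / (m - j)%:R)
   + \sum_(j < N.+1) p * (if (j : nat) is j'.+1 then P`_j' / (m.-1 - j')%:R else 0)).
  rewrite -big_split; apply: eq_bigr => -[j jN] _ /=.
  rewrite mulrDl coefD coefCM -scalerAl coefZ coefXM.
  case: j jN => [|j] jN /=; first by rewrite !mulr0 !addr0 mulrA.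
  by rewrite mulrDl -!mulrA subnS -subn1 subnAC subn1.
congr (_ + _); first by rewrite mulr_sumr.
by rewrite big_ord_recl /= mulr0 add0r mulr_sumr.
Qed.

(** For p uniform in the product of the [M i], the events [p i \in R i] are independent of
    probability |R i|/k. Their generating polynomials multiply out to a sum of monomials over all
    p. *)
Lemma sum_family_mean_inv (I T : finType) (M R : I -> {set T}) (k : nat) :
    (0 < k)%N -> (forall i, #|M i| = k) -> (forall i, R i \subset M i) ->
  \sum_(p in family (fun i => mem (M i)))
      (k - \sum_i (p i \in R i))%:R^-1 =
    k%:R ^+ #|I| * mean_inv [seq #|R i|%:R / k%:R | i <- enum I] k :> F.
Proof.
move=> k0 Mk RM; have kF : k%:R != 0 :> F by rewrite pnatr_eq0; lia.
set s := (fun p : {ffun I -> T} => \sum_i (p i \in R i))%N.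
rewrite -(@coef_prod_mean_inv _ #|I|.+1) ?size_map -?enumT -?cardE //.
have factor i : (1 - #|R i|%:R / k%:R)%:P + (#|R i|%:R / k%:R) *: 'X =
   k%:R^-1 *: \sum_(x in M i) 'X^(x \in R i) :> {poly F}.
  rewrite (big_setID (R i)) /= (setIidPr (RM i)).
  rewrite (eq_bigr (fun=> 'X)) => [|x ->]; last by rewrite expr1.
  rewrite [X in _ *: (_ + X)](eq_bigr (fun=> 1)) => [|x]; last first.
    by rewrite !inE => /andP[/negPf-> _]; rewrite expr0.
  rewrite !sumr_const cardsD Mk (setIidPr (RM i)) scalerDr addrC.
  rewrite -!scaler_nat !scalerA ![k%:R^-1 * _]mulrC alg_polyC.
  by rewrite natrB ?mulrBl ?mulfV // -(Mk i) subset_leq_card.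
rewrite big_map big_enum /= (eq_bigr _ (fun i _ => factor i)).
rewrite scaler_prod bigA_distr_big_dep /=.
rewrite prodr_const -/(#|I|) exprVn mulr_sumr.
under [RHS]eq_bigr => j _.
  rewrite coefZ -mulrA mulVKf ?expf_neq0 // coef_sum mulr_suml.
  under eq_bigr => p _ do rewrite prodrXr coefXn -[(\sum_i _)%N]/(s p).
  over.
rewrite exchange_big /=; apply: eq_bigr => p _.
have sp : (s p < #|I|.+1)%N.
  rewrite ltnS -sum1_card; apply: leq_sum => i _; exact: leq_b1.
rewrite -[(\sum_i _)%N]/(s p) (bigD1 (Ordinal sp)) //= eqxx mul1r big1 ?addr0 // => j.
by rewrite -val_eqE /= => /negPf->; rewrite mul0r.
Qed.
End ProdInverse.

Lemma sum_card_setI_disjoint (I T : finType) (M : I -> {set T}) (S : {set T}) :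
    (forall i i', i != i' -> [disjoint M i & M i']) ->
  \sum_i #|M i :&: S| <= #|S|.
Proof.
move=> disM.
have cardE i : #|M i :&: S| = \sum_(x in S) (x \in M i).
  rewrite -sum1_card big_mkcond [RHS]big_mkcond; apply: eq_bigr => x _.
  by rewrite inE; case: (x \in M i); case: (x \in S).
under eq_bigr => i _ do rewrite cardE.
rewrite exchange_big -[leqRHS]sum1_card; apply: leq_sum => x _ /=.
have [/existsP[i xi]|/existsPn x0] := boolP [exists i, x \in M i].
  rewrite (bigD1 i) //= xi big1 // => i' i'i.
  by case: (boolP (x \in M i')) => // xi'; have /pred0P/(_ x) := disM _ _ i'i; rewrite /= xi xi'.
by rewrite big1 // => i _; rewrite (negPf (x0 i)).
Qed.

Lemma card_family_prod (I T : finType) (F : I -> pred T) :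
  #|family F| = \prod_i #|F i|.
Proof.
rewrite -sum1_card; transitivity (\sum_(p in family F) \prod_(i : I) 1).
  by apply: eq_bigr => p _; rewrite big1.
rewrite -(bigA_distr_big_dep F (fun _ _ => 1)).
by apply: eq_bigr => i _; rewrite sum1_card.
Qed.

Lemma card_family_const (I T : finType) (M : I -> {set T}) k :
  (forall i, #|M i| = k) -> #|family (fun i => mem (M i))| = k ^ #|I|.
Proof.
move=> Mk; rewrite card_family_prod (eq_bigr (fun=> k)) ?prod_nat_const // => i _.
exact: Mk.
Qed.

(** * Counting the colours available in the fibre of w, given the fibre of u *)

Section CrossCount.
Variables (I T : finType) (M N N' : I -> {set T}) (k : nat).
Hypotheses (k1 : 1 < k) (Ik : #|I| < k).
Hypotheses (Mk : forall i, #|M i| = k) (Nk : forall i, #|N i| = k).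
Hypothesis N'N : forall i, N' i \subset N i.
Hypothesis disM : forall i i', i != i' -> [disjoint M i & M i'].
Hypothesis N'P : forall i,
  #|N' i| < k \/ (forall i', i' != i -> [disjoint N' i & M i']).

(** [M i] and [N i] stand for the lists of u and w at i, [N' i] for the colours of [N i] that are
    not exempt, and p for a colouring of the fibre of u. *)
Let avail (p : {ffun I -> T}) i := #|N i :\: (N' i :&: [set p i' | i' in I])|.
Let MF : pred {ffun I -> T} := family (fun i => mem (M i)).

Lemma availE p i : avail p i = k - #|N' i :&: [set p i' | i' in I]|.
Proof.
rewrite /avail cardsD Nk; congr (_ - #|pred_of_set _|).
by apply/setIidPr; apply: subset_trans (subsetIl _ _) (N'N i).
Qed.

Lemma card_hit_le (p : {ffun I -> T}) (S : {set T}) :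
  #|S :&: [set p i | i in I]| <= \sum_i (p i \in S).
Proof.
have /subset_leq_card le1 : S :&: [set p i | i in I] \subset [set p i | i in [set i | p i \in S]].
  by apply/subsetP => x /setIP[xS /imsetP[i _ xE]]; apply/imsetP; exists i; rewrite ?inE -?xE.
apply: leq_trans le1 _; apply: leq_trans (leq_imset_card _ _) _.
by rewrite -sum1_card big_mkcond leq_sum // => i _; rewrite inE; case: ifP.
Qed.

Local Open Scope ring_scope.

Lemma avail_gt0 p i : (0 < avail p i)%N.
Proof.
rewrite availE subn_gt0; apply: leq_ltn_trans (subset_leq_card (subsetIr _ _)) _.
exact: leq_ltn_trans (leq_imset_card _ _) Ik.
Qed.

(** If [N' i] has fewer than k colours, disjointness of the [M i'] bounds the total mean of the hits
    by |N' i|/k, and [mean_inv_bound] applies. *)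
Lemma sum_avail_inv i :
  \sum_(p in MF) (avail p i)%:R^-1 <= k%:R ^+ #|I| / k.-1%:R :> rat.
Proof.
have [N'k|N'dis] := N'P i.
  pose R i' := M i' :&: N' i.
  have RM i' : R i' \subset M i' by exact: subsetIl.
  have k0 : (0 < k)%N by lia.
  have := @sum_family_mean_inv rat I T M R k k0 Mk RM.
  set rhs := _ * _ => sumE; apply: (@le_trans _ _ rhs); last first.
    rewrite ler_wpM2l ?exprn_ge0 //.
    have -> : [seq #|R i0|%:R / k%:R | i0 <- enum I] =
       [seq r%:R / k%:R | r <- [seq #|R i0| | i0 <- enum I]] :> seq rat by rewrite -map_comp.
    apply: mean_inv_bound => //; rewrite sumnE big_map big_enum /=.
    exact: leq_ltn_trans (sum_card_setI_disjoint _ disM) N'k.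
  rewrite -sumE; apply: ler_sum => p /familyP pM.
  have hit_lt : (\sum_i' (p i' \in R i') < k)%N.
    apply: leq_ltn_trans Ik; rewrite -sum1_card.
    by apply: leq_sum => i' _; exact: leq_b1.
  rewrite lef_pV2 ?posrE ?ltr0n ?avail_gt0 ?subn_gt0 // ler_nat availE.
  rewrite leq_sub2l // (leq_trans (card_hit_le _ _)) // leq_sum // => i' _.
  by rewrite inE pM.
(* In the other case only [p i] can hit [N' i], so at least k - 1 colours remain for every p. *)
have -> : k%:R ^+ #|I| / k.-1%:R = \sum_(p in MF) k.-1%:R^-1 :> rat.
  by rewrite sumr_const (card_family_const Mk) -[RHS]mulr_natl natrX.
apply: ler_sum => p /familyP pM.
rewrite lef_pV2 ?posrE ?ltr0n ?avail_gt0 //; last by lia.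
rewrite ler_nat availE -subn1 leq_sub2l // -(cards1 (p i)) subset_leq_card //.
apply/subsetP => x /setIP[xN' /imsetP[i' _ xE]]; rewrite inE xE.
have [->//|i'i] := eqVneq i' i.
by have /pred0P/(_ x) := N'dis _ i'i; rewrite /= xN' xE [_ \in _]pM.
Qed.

(** AM-GM is applied for each p to the ratios [avail p i] / (k - 1). After summation over p, the
    correction term of each i is nonnegative by [sum_avail_inv]. *)
Lemma cross_count :
  ((k * k.-1) ^ #|I| <= \sum_(p in MF) \prod_i avail p i)%N.
Proof.
rewrite -(ler_nat rat) natr_sum natrX natrM exprMn.
have km1 : 0 < k.-1%:R :> rat by rewrite ltr0n; lia.
apply: (@le_trans _ _ (\sum_(p in MF) k.-1%:R ^+ #|I| *
   (1 + \sum_i (1 - ((avail p i)%:R / k.-1%:R)^-1)))); last first.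
  apply: ler_sum => p _; rewrite natr_prod.
  have := @prod_ge_sum_inv rat I (fun i => (avail p i)%:R / k.-1%:R).
  rewrite prodf_div prodr_const -/(#|I|) ler_pdivlMr ?exprn_gt0 // mulrC.
  by apply=> i; rewrite divr_gt0 // ltr0n avail_gt0.
rewrite -mulr_sumr mulrC ler_wpM2l ?exprn_ge0 ?(ltW km1) //.
rewrite [leRHS]big_split /= sumr_const (card_family_const Mk) -natrX lerDl exchange_big /=.
apply: sumr_ge0 => i _; rewrite sumrB sumr_const (card_family_const Mk) subr_ge0.
under eq_bigr => p _ do rewrite invf_div.
by rewrite -mulr_sumr mulrC -ler_pdivlMr // natrX sum_avail_inv.
Qed.
End CrossCount.

(** * Systems of distinct representatives: existence and counting *)

Section Representatives.
Variables V T : finType.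
Implicit Types (L : V -> {set T}) (S : {set V}).

Definition sdr L (g : V -> T) := (forall v, g v \in L v) /\ injective g.

Lemma leq_cardsD1 (A : {set T}) x : #|A|.-1 <= #|A :\ x|.
Proof. by rewrite (cardsD1 x A); case: (x \in A) => //=; rewrite add0n leq_pred. Qed.

(** The vertex v is coloured last. Any other vertex has at most |S| - 2 predecessors, so |S| - 1
    colours suffice for it. *)
Lemma greedy_sdr L S v (g0 : V -> T) : v \in S ->
    {in S, forall y, #|S|.-1 <= #|L y|} -> #|S| <= #|L v| ->
  exists g : V -> T, {in S, forall y, g y \in L y} /\ {in S &, injective g}.
Proof.
have [n] := ubnP #|S|; elim: n => // n IH in L S v * => Sn vS Ly Lv.
have [S1|[y ySv]] := set_0Vmem (S :\ v).
  have SE : S = [set v] by rewrite -(setD1K vS) S1 setU0.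
  have /card_gt0P[x xL] : 0 < #|L v| by apply: leq_trans Lv; rewrite SE cards1.
  exists (fun=> x); split=> [y|y z]; rewrite SE !inE; first by move/eqP->.
  by move=> /eqP-> /eqP->.
have [yv yS] := setD1P ySv.
have Sy : #|S| = #|S :\ y|.+1 by rewrite (cardsD1 y) yS.
have vSy : v \in S :\ y by rewrite !inE eq_sym yv.
have Sy0 : 0 < #|S :\ y| by apply/card_gt0P; exists v.
have /card_gt0P[x xL] : 0 < #|L y| by apply: leq_trans (Ly _ yS); rewrite Sy.
have [||z /setD1P[_ zS]||g [gL g_inj]] := IH (fun z => L z :\ x) (S :\ y) v => //.
- by rewrite -Sy.
- apply: leq_trans (leq_cardsD1 _ _); rewrite -subn1 -subn1 leq_sub2r //.
  by rewrite (leq_trans _ (Ly _ zS)) // Sy.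
- by apply: leq_trans (leq_cardsD1 _ _); rewrite -ltnS -Sy (leq_trans Lv) // leqSpred.
have gE z : z \in S -> z != y -> g z \in L z :\ x.
  by move=> zS zy; apply: gL; rewrite !inE zy.
exists (fun z => if z == y then x else g z); split=> [z zS|z t zS tS].
  by case: eqVneq => [->//|/(gE z zS)/setD1P[]].
case: (eqVneq z y) => [->|zy]; case: (eqVneq t y) => [->|ty] //.
- by move=> xE; move: (gE t tS ty); rewrite -xE !inE eqxx.
- by move=> xE; move: (gE z zS zy); rewrite xE !inE eqxx.
by apply: g_inj; rewrite !inE ?zy ?ty.
Qed.

Lemma sdr_extend L v x (g0 : V -> T) : x \in L v ->
    (forall y, #|V| <= #|L y|) ->
  exists g, sdr L g /\ g v = x.
Proof.
move=> xL VL.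
have [g [gL g_inj]] : exists g : V -> T, {in [set~ v], forall y, g y \in L y :\ x}
     /\ {in [set~ v] &, injective g}.
  have [S0|[y yv]] := set_0Vmem [set~ v].
    by exists g0; rewrite S0; split=> y; rewrite inE.
  have LV z : #|[set~ v]| <= #|L z :\ x|.
    rewrite cardsC1; apply: leq_trans (leq_cardsD1 _ _).
    by rewrite -!subn1 leq_sub2r.
  apply: (greedy_sdr g0 yv) => // z _; exact: leq_trans (leq_pred _) (LV z).
have gE z : z != v -> g z \in L z :\ x by move=> zv; apply: gL; rewrite !inE.
exists (fun z => if z == v then x else g z); rewrite eqxx; split=> //; split=> [z|z t].
  by case: eqVneq => [->//|/gE/setD1P[]].
case: (eqVneq z v) => [->|zv]; case: (eqVneq t v) => [->|tv] //.
- by move=> xE; move: (gE t tv); rewrite -xE !inE eqxx.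
- by move=> xE; move: (gE z zv); rewrite xE !inE eqxx.
by apply: g_inj; rewrite !inE.
Qed.

(* The only obstruction is that all lists coincide: otherwise colour first a
   vertex [u] by a colour missing from [L v], and [v] last. *)
Lemma sdr_or_constant L (v0 : V) (g0 : V -> T) : (forall v, #|V|.-1 <= #|L v|) ->
  (exists g, sdr L g) \/ (exists B : {set T}, #|B| = #|V|.-1 /\ forall v, L v = B).
Proof.
move=> VL; have V0 : 0 < #|V| by apply/card_gt0P; exists v0.
have [/existsP[v Vv]|/existsPn Lsmall] := boolP [exists v, #|V| <= #|L v|].
  left; have [||g [gL g_inj]] := @greedy_sdr L setT v g0 (in_setT v); rewrite ?cardsT //.
  by exists g; split=> [y|y z]; [exact: gL | exact: g_inj].
have LE v : #|L v| = #|V|.-1.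
  by apply/eqP; rewrite eqn_leq VL andbT -ltnS prednK // ltnNge.
have [/forallP Lconst|/forallPn[u Luv]] := boolP [forall v, L v == L v0].
  by right; exists (L v0); split=> // v; exact/eqP.
left; have [x xu xv] : exists2 x, x \in L u & x \notin L v0.
  apply/subsetPn; apply: contra Luv => Luv.
  by rewrite eqEcard Luv !LE leqnn.
have uv : v0 \in [set~ u] by rewrite !inE; apply: contraNneq Luv => ->.
have Lv0 : L v0 :\ x = L v0 by apply/setDidPl; rewrite disjoint_sym disjoints1.
have [||g [gL g_inj]] := @greedy_sdr (fun y => L y :\ x) [set~ u] v0 g0 uv.
- by move=> y _; rewrite cardsC1 -(LE y); exact: leq_cardsD1.
- by rewrite Lv0 LE cardsC1.
have gE z : z != u -> g z \in L z :\ x by move=> zu; apply: gL; rewrite !inE.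
exists (fun z => if z == u then x else g z); split=> [z|z t].
  by case: eqVneq => [->//|/gE/setD1P[]].
case: (eqVneq z u) => [->|zu]; case: (eqVneq t u) => [->|tu] //.
- by move=> xE; move: (gE t tu); rewrite -xE !inE eqxx.
- by move=> xE; move: (gE z zu); rewrite xE !inE eqxx.
by apply: g_inj; rewrite !inE.
Qed.

Definition sdrb L (g : {ffun V -> T}) := [forall v, g v \in L v] && injectiveb g.

Lemma sdrbP L (g : {ffun V -> T}) : reflect (sdr L g) (sdrb L g).
Proof.
apply: (iffP andP) => -[].
  by move=> /forallP gL /injectiveP.
by move=> gL g_inj; split; [exact/forallP | exact/injectiveP].
Qed.

(** Pinning [g] to [d] off [s] counts each colouring of [s] once. Each choice removes at most one
    colour from the later lists; in the induction the colour of the head moves into [d]. *)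
Lemma card_partial_sdr L (s : seq V) (d : V -> T) m : uniq s ->
    {in s, forall v, m <= #|L v|} ->
  m ^_ (size s) <= #|[set g : {ffun V -> T} |
    [forall v, if v \in s then g v \in L v else g v == d v] & uniq (map g s)]|.
Proof.
elim: s => [|v s IH] in L d m *.
  move=> _ _; rewrite ffactn0; apply/card_gt0P; exists (finfun d).
  by rewrite !inE andbT; apply/forallP => v /=; rewrite ffunE.
rewrite cons_uniq => /andP[vs us] mL; rewrite [size _]/= ffactnS.
set A := [set g | _ & _].
have -> : #|A| = \sum_x #|[set g in A | g v == x]|.
  rewrite -sum1_card (partition_big (fun g : {ffun V -> T} => g v) predT) //=.
  by apply: eq_bigr => x _; rewrite -sum1_card; apply: eq_bigl => g; rewrite inE.
apply: leq_trans (_ : \sum_(x in L v) m.-1 ^_ (size s) <= _).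
  by rewrite sum_nat_const leq_mul2r mL ?orbT // mem_head.
rewrite big_mkcond; apply: leq_sum => x _; case: ifP => // xL.
apply: leq_trans (IH (fun y => L y :\ x) (fun y => if y == v then x else d y) _ us _) _.
  move=> y ys; apply: leq_trans (leq_cardsD1 _ _).
  by rewrite -!subn1 leq_sub2r // mL // inE ys orbT.
apply/subset_leq_card/subsetP => g; rewrite !inE => /andP[/forallP gP ug].
have gv : g v = x by have := gP v; rewrite (negPf vs) eqxx => /eqP.
rewrite gv eqxx andbT map_cons cons_uniq ug andbT; apply/andP; split.
  apply/forallP => y; have := gP y; rewrite in_cons.
  by case: (eqVneq y v) => [->|yv] /=; [rewrite gv | case: ifP => // _ /setD1P[]].
apply/negP => /mapP[y ys gvy]; have := gP y; rewrite ys !inE -gvy gv eqxx.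
by [].
Qed.

Lemma card_sdr L k (t0 : T) : (forall v, #|L v| = k) ->
  k ^_ #|V| <= #|[set g | sdrb L g]|.
Proof.
move=> Lk; have := card_partial_sdr (m := k) (L := L) (fun=> t0) (enum_uniq V).
rewrite -cardE => count; apply: leq_trans (count _) _ => [v _|]; first by rewrite Lk.
apply/subset_leq_card/subsetP => g; rewrite !inE => /andP[/forallP gL g_inj].
apply/andP; split; last exact: g_inj.
by apply/forallP => v; have := gL v; rewrite mem_enum.
Qed.

(** Deleting p and q leaves at least k - 2 colours at each of the |V| - 2 other vertices. *)
Lemma card_sdr_fix2 L k u w p q : u != w -> p \in L u -> q \in L w -> p != q ->
    (forall v, #|L v| = k) ->
  (k - 2) ^_ (#|V| - 2) <= #|[set g | [&& sdrb L g, g u == p & g w == q]]|.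
Proof.
move=> uw pL qL pq Lk; pose S := ~: [set u; w].
have sS : size (enum S) = #|V| - 2 by rewrite -cardE cardsCs setCK cards2 uw.
rewrite -sS; apply: leq_trans (card_partial_sdr (fun v => if v == u then p else q)
    (L := fun v => L v :\ p :\ q) (enum_uniq S) _) _.
  move=> v _; rewrite -(Lk v) subn2 -!subn1.
  apply: leq_trans (leq_cardsD1 _ _); rewrite -subn1 leq_sub2r //.
  by rewrite subn1 leq_cardsD1.
apply/subset_leq_card/subsetP => g; rewrite !inE => /andP[/forallP gP ug].
have gS v : v != u -> v != w -> g v \in L v :\ p :\ q.
  by move=> vu vw; have := gP v; rewrite mem_enum !inE negb_or vu vw.
have gu : g u = p by have := gP u; rewrite mem_enum !inE eqxx => /eqP.
have gw : g w = q by have := gP w; rewrite mem_enum !inE eqxx orbT /= (eq_sym w) (negPf uw) => /eqP.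
rewrite gu gw !eqxx !andbT; apply/sdrbP; split=> [v|v v'].
  have [->|vu] := eqVneq v u; first by rewrite gu.
  have [->|vw] := eqVneq v w; first by rewrite gw.
  by have /setD1P[_ /setD1P[]] := gS v vu vw.
have inS x : x != u -> x != w -> x \in S by move=> xu xw; rewrite !inE negb_or xu.
have /dinjectiveP g_inj : dinjectiveb g (mem S) by exact: ug.
case: (eqVneq v u) => [->|vu]; case: (eqVneq v' u) => [->|v'u] //.
- have [->|v'w] := eqVneq v' w; first by rewrite gu gw => pqE; rewrite pqE eqxx in pq.
  by rewrite gu => pE; move: (gS v' v'u v'w); rewrite -pE !inE eqxx !andbF.
- have [->|vw] := eqVneq v w; first by rewrite gu gw => pqE; rewrite pqE eqxx in pq.
  by rewrite gu => pE; move: (gS v vu vw); rewrite pE !inE eqxx !andbF.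
case: (eqVneq v w) => [->|vw]; case: (eqVneq v' w) => [->|v'w] //.
- by rewrite gw => qE; move: (gS v' v'u v'w); rewrite -qE !inE eqxx.
- by rewrite gw => qE; move: (gS v vu vw); rewrite qE !inE eqxx.
by apply: g_inj; exact: inS.
Qed.
End Representatives.

(** * Colouring the product of a complete graph with a complete bipartite graph *)

Section Product.
Variables (V I J T : finType) (v0 : V) (i0 : I).
Variables (LA : V -> I -> {set T}) (LB : V -> J -> {set T}).

(** List colourability of the product of the complete graph on V with the biclique on I and J: a
    proper colouring of a complete copy is a system of distinct representatives. *)
Definition biclique_colorable := exists (c : I -> V -> T) (d : J -> V -> T),
  [/\ forall i, sdr (LA^~ i) (c i), forall j, sdr (LB^~ j) (d j)
    & forall v i j, c i v != d j v].

Definition used (c : I -> V -> T) v := [set c i v | i in I].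

Lemma card_used_le c v : #|used c v| <= #|I|.
Proof. exact: leq_imset_card. Qed.

Lemma colorable_of_residual (c : I -> V -> T) :
    (forall i, sdr (LA^~ i) (c i)) ->
    (forall j, exists d : V -> T, sdr (fun v => LB v j :\: used c v) d) ->
  biclique_colorable.
Proof.
move=> cLA /fin_all_exists[d dP]; exists c, d; split=> // [j|v i j].
  by have [dL d_inj] := dP j; split=> // v; have /setDP[] := dL v.
have [/(_ v)/setDP[_ dN] _] := dP j.
by apply: contraNneq dN => <-; apply: imset_f.
Qed.

(** Any colouring of the I side leaves at least |V| colours in every residual list of the J side. *)
Lemma colorable_big k : #|V| + #|I| <= k ->
  (forall v i, #|LA v i| = k) -> (forall v j, #|LB v j| = k) ->
  biclique_colorable.
Proof.
move=> nk LAk LBk.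
have [t0 _] : exists x, x \in LA v0 i0.
  apply/card_gt0P; rewrite LAk; apply: leq_trans nk.
  by rewrite addn_gt0; apply/orP; left; apply/card_gt0P; exists v0.
have sdr_ex (L : V -> {set T}) : (forall v, #|V| <= #|L v|) -> exists g, sdr L g.
  move=> VL; have /card_gt0P[x xL] : 0 < #|L v0|.
    by apply: leq_trans (VL v0); apply/card_gt0P; exists v0.
  by have [g []] := sdr_extend (fun=> t0) xL VL; exists g.
have [|c cP] := @fin_all_exists I (fun=> V -> T) (fun i c => sdr (LA^~ i) c).
  by move=> i; apply: sdr_ex => v; rewrite LAk (leq_trans _ nk) // leq_addr.
apply: (colorable_of_residual cP) => j; apply: sdr_ex => v.
rewrite cardsD LBk; apply: leq_trans (leq_sub2l _ (subset_leq_card (subsetIr _ _))).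
move: (card_used_le c v) nk; move: #|used c v| #|V| #|I| => x y z; lia.
Qed.

Hypothesis LAk : forall v i, #|LA v i| = #|V|.-1 + #|I|.
Hypothesis LBk : forall v j, #|LB v j| = #|V|.-1 + #|I|.

Let k := #|V|.-1 + #|I|.

Let Vk : #|V| <= k.
Proof.
have V0 : 0 < #|V| by apply/card_gt0P; exists v0.
by rewrite -(prednK V0) /k -addn1 leq_add2l; apply/card_gt0P; exists i0.
Qed.

(** By [sdr_or_constant], the only possible obstruction to extending [c] to the copy at [j]. *)
Definition kills (j : J) (c : {ffun I -> {ffun V -> T}}) :=
  [exists B : {set T}, (#|B| == #|V|.-1) && [forall v, LB v j :\: used (fun i => c i) v == B]].

Lemma colorable_of_unkilled (c : {ffun I -> {ffun V -> T}}) :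
  (forall i, sdr (LA^~ i) (c i)) -> (forall j, ~~ kills j c) -> biclique_colorable.
Proof.
move=> cLA unkilled; apply: (colorable_of_residual cLA) => j.
have := @sdr_or_constant V T (fun v => LB v j :\: used (fun i => c i) v) v0 (c i0).
case=> // [v|[B [B1 BE]]].
  rewrite cardsD LBk; apply: leq_trans (leq_sub2l _ (subset_leq_card (subsetIr _ _))).
  by apply: leq_trans (leq_sub2l _ (card_used_le _ v)); rewrite addnK.
case/negP: (unkilled j); apply/existsP; exists B; rewrite B1 eqxx /=.
by apply/forallP => v; rewrite BE.
Qed.

(** A residual list of |V| - 1 colours means that |I| colours of [LB v j] are used at v. No more
    than |I| are used there, so all of them lie in the list, and j and B determine them. *)
Lemma killsP j c : kills j c -> exists B : {set T}, [/\ #|B| = #|V|.-1,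
  forall v, B \subset LB v j & forall v, used (fun i => c i) v = LB v j :\: B].
Proof.
case/existsP=> B /andP[/eqP B1 /forallP BE]; exists B.
have LBE v : LB v j :\: used (fun i => c i) v = B by apply/eqP.
split=> // v; first by rewrite -(LBE v) subsetDl.
have le_used : #|used (fun i => c i) v| <= #|LB v j :&: used (fun i => c i) v|.
  apply: leq_trans (card_used_le _ _) _.
  have := cardsID (used (fun i => c i) v) (LB v j).
  by rewrite LBE LBk B1 addnC => /addnI->.
have usedL : LB v j :&: used (fun i => c i) v = used (fun i => c i) v.
  by apply/eqP; rewrite eqEcard subsetIr.
by rewrite -{1}usedL -(LBE v) setDDr setDv set0U.
Qed.

(** Repeating a colour at v leaves fewer than |I| used colours there, while a killed colouring uses
    exactly |I|. *)
Lemma colorable_of_overlap v i i' : i != i' -> ~~ [disjoint LA v i & LA v i'] ->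
  biclique_colorable.
Proof.
move=> ii' /pred0Pn[x /andP[/= xi xi']].
have ext h : exists g : {ffun V -> T}, sdr (LA^~ h) g /\ (x \in LA v h -> g v = x).
  have VL y : #|V| <= #|LA y h| by rewrite LAk.
  have /card_gt0P[y yL] : 0 < #|LA v h| by apply: leq_trans (VL v); apply/card_gt0P; exists v.
  pose z := if x \in LA v h then x else y.
  have zL : z \in LA v h by rewrite /z; case: ifP.
  have [g [[gL g_inj] gz]] := sdr_extend (fun=> x) zL VL; exists (finfun g).
  split; last by move=> xL; rewrite ffunE gz /z xL.
  by split=> [t|t t']; rewrite !ffunE; [exact: gL|exact: g_inj].
have [c0 cP] := fin_all_exists ext; pose c := finfun c0.
have cE h : c h = c0 h by rewrite ffunE.
apply: (@colorable_of_unkilled c) => [h|j]; first by rewrite cE; have [] := cP h.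
apply/negP => /killsP[B [B1 BL usedE]].
have : #|used (fun i => c i) v| = #|I|.
  by rewrite usedE cardsD (setIidPr (BL v)) LBk B1 addKn.
move/eqP/imset_injP => /(_ i i' isT isT); rewrite !cE.
have [_ ->//] := cP i; have [_ ->//] := cP i'.
by move=> /(_ erefl) iE; rewrite iE eqxx in ii'.
Qed.

Hypothesis disLA : forall v i i', i != i' -> [disjoint LA v i & LA v i'].

Lemma LA_index v i i' x : x \in LA v i -> x \in LA v i' -> i = i'.
Proof.
move=> xi xi'; apply/eqP/negPn/negP => ii'.
by have /pred0P/(_ x) := disLA v ii'; rewrite /= xi xi'.
Qed.

(** As the lists at v are disjoint, a used colour reveals the index i at which it is used. *)
Lemma used_inj (c c' : {ffun I -> {ffun V -> T}}) :
    (forall i, sdr (LA^~ i) (c i)) -> (forall i, sdr (LA^~ i) (c' i)) ->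
  (forall v, used (fun i => c i) v = used (fun i => c' i) v) -> c = c'.
Proof.
move=> cL c'L usedE; apply/ffunP => i; apply/ffunP => v.
have : c i v \in used (fun i => c' i) v by rewrite -usedE; apply: imset_f.
case/imsetP=> i' _ cE; rewrite cE; congr (c' _ v); apply/esym.
apply: (@LA_index v _ _ (c i v)); first by have [] := cL i.
by rewrite cE; have [] := c'L i'.
Qed.

(** If all of [CC] were killed, choosing a killer for each member would inject [CC] into J. *)
Lemma colorable_of_kills_inj (CC : {set {ffun I -> {ffun V -> T}}}) :
    (forall c, c \in CC -> forall i, sdr (LA^~ i) (c i)) ->
    (forall j, {in CC &, forall c c', kills j c -> kills j c' -> c = c'}) ->
    #|J| < #|CC| ->
  biclique_colorable.
Proof.
move=> CCL kills_inj JC.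
have [/existsP[c /andP[cC /forallP c_unkilled]]|/existsPn all_killed] :=
    boolP [exists c, (c \in CC) && [forall j, ~~ kills j c]].
  exact: (colorable_of_unkilled (CCL c cC)).
have [c0 c0C] : exists c, c \in CC by apply/card_gt0P; exact: leq_trans JC.
have [j0 _] : exists j, kills j c0.
  by have := all_killed c0; rewrite c0C /= => /forallPn[j]; rewrite negbK; exists j.
have killer c : exists j, (c \in CC) ==> kills j c.
  case cC: (c \in CC) => /=; last by exists j0.
  have := all_killed c; rewrite cC /= => /forallPn[j]; rewrite negbK.
  by exists j.
have [f fP] := fin_all_exists killer.
suff /leq_card_in : {in CC &, injective f} by rewrite leqNgt JC.
move=> c c' cC c'C fE; apply: (kills_inj (f c)) => //.
  by have := fP c; rewrite cC.
by have := fP c'; rewrite c'C fE.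
Qed.

Lemma kills_inj_card1 (c c' : {ffun I -> {ffun V -> T}}) j : #|V| = 1 ->
    (forall i, sdr (LA^~ i) (c i)) -> (forall i, sdr (LA^~ i) (c' i)) ->
  kills j c -> kills j c' -> c = c'.
Proof.
move=> V1 cL c'L /killsP[B [B1 _ usedE]] /killsP[B' [B'1 _ usedE']].
apply: used_inj => // v; rewrite usedE usedE'.
by move/eqP: B1; move/eqP: B'1; rewrite V1 !cards_eq0 => /eqP-> /eqP->.
Qed.

(* If [c], [c'] are killed through [B <> B'], then [c] uses a colour of
   [B' :\: B] and [c'] one of [B :\: B'], each at both [u] and [w]; they can be
   taken in the same list at [w], where at most one colour is exempt. *)
Lemma kills_inj_cross (u w : V) (N' : I -> {set T})
    (c c' : {ffun I -> {ffun V -> T}}) j :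
    (forall i, {in LA w i :\: N' i &, forall x y, x = y}) ->
    (forall i, sdr (LA^~ i) (c i)) -> (forall i, sdr (LA^~ i) (c' i)) ->
    (forall i, c i w \notin N' i :&: used (fun i => c i) u) ->
    (forall i, c' i w \notin N' i :&: used (fun i => c' i) u) ->
  kills j c -> kills j c' -> c = c'.
Proof.
move=> exempt cL c'L cN c'N /killsP[B [B1 BL usedE]] /killsP[B' [B'1 B'L usedE']].
have [BB'|BB'] := eqVneq B B'.
  by apply: used_inj => // v; rewrite usedE usedE' BB'.
have [x xB' xB] : exists2 x, x \in B' & x \notin B.
  apply/subsetPn; apply: contraNN BB' => B'B.
  by rewrite eq_sym eqEcard B'B B1 B'1 leqnn.
have x_used v : x \in used (fun i => c i) v.
  by rewrite usedE inE xB (subsetP (B'L v)).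
have /imsetP[i _ xE] := x_used w.
have x'L : c' i w \in LB w j :\: B'.
  by rewrite -usedE'; apply: imset_f.
have x'B : c' i w \in B.
  apply: contraT => x'B; have : c' i w \in used (fun i => c i) w.
    by move: x'L; rewrite usedE !inE x'B => /andP[].
  case/imsetP=> i' _ x'E.
  have ii' : i = i'.
    apply: (@LA_index w _ _ (c' i w)); first by have [] := c'L i.
    by rewrite x'E; have [] := cL i'.
  by move: x'L; rewrite x'E -ii' -xE inE xB'.
have x'_used : c' i w \in used (fun i => c' i) u.
  by rewrite usedE' inE (subsetP (BL u)) // andbT; case/setDP: x'L.
have xN' : x \notin N' i by have := cN i; rewrite -xE inE x_used andbT.
have xN : c i w \in LA w i :\: N' i.
  by rewrite inE -xE xN' xE; have [/(_ w)] := cL i.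
have x'N' : c' i w \notin N' i by have := c'N i; rewrite inE x'_used andbT.
have x'N : c' i w \in LA w i :\: N' i.
  by rewrite inE x'N'; have [/(_ w)] := c'L i.
by move: x'L; rewrite -(exempt i _ _ xN x'N) -xE inE xB'.
Qed.

(** The colourings are sorted by their fibre p at u and then, for each i, by the colour q at w.
    [cross_count] bounds the choices of p and q, and each i leaves Q ways to colour the other
    vertices. *)
Lemma card_noncrossing (u w : V) (N' : I -> {set T}) : u != w ->
    (forall i, N' i \subset LA w i) ->
    (forall i, #|N' i| < k \/ (forall i', i' != i -> [disjoint N' i & LA u i'])) ->
    (forall i x, x \in LA u i -> x \in LA w i -> x \in N' i) ->
  (k ^_ #|V|) ^ #|I| <=
    #|[set c : {ffun I -> {ffun V -> T}} | [forall i, sdrb (LA^~ i) (c i)]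
        && [forall i, c i w \notin N' i :&: used (fun i => c i) u]]|.
Proof.
move=> uw N'N N'P N'same.
have V2 : 1 < #|V| by have := max_card (mem [set u; w]); rewrite cards2 uw.
have Ik : #|I| < k by rewrite /k -[X in X < _]add0n ltn_add2r -subn1 subn_gt0.
have k1 : 1 < k by apply: leq_trans Ik; apply/card_gt0P; exists i0.
set CC := [set c | _].
pose MF := family (fun i => mem (LA u i)).
pose Q := (k - 2) ^_ (#|V| - 2).
have -> : k ^_ #|V| = k * k.-1 * Q.
  by rewrite -{1}(subnK V2) addn2 !ffactnS mulnA -[k.-1.-1]subn2.
pose X (p : {ffun I -> T}) i :=
  [set g : {ffun V -> T} | [&& sdrb (LA^~ i) g, g u == p i
      & g w \in LA w i :\: (N' i :&: [set p i' | i' in I])]].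
have XC p : \prod_i #|X p i| <= #|[set c in CC | [ffun i => c i u] == p]|.
  rewrite -(card_family_prod (fun i => mem (X p i))); apply/subset_leq_card/subsetP => c.
  move=> /familyP cX; have cXi i : c i \in X p i := cX i.
  have pE : [ffun i => c i u] = p.
    apply/ffunP => i; rewrite ffunE; have := cXi i; rewrite inE.
    by case/and3P=> _ /eqP.
  rewrite !inE pE eqxx andbT; apply/andP; split; apply/forallP => i.
    by have := cXi i; rewrite inE => /and3P[].
  have := cXi i; rewrite inE => /and3P[_ _ /setDP[_]].
  rewrite -pE; congr (_ \notin _ :&: _); apply/setP => x.
  by apply/imsetP/imsetP => -[i' _ ->]; exists i'; rewrite ?ffunE.
apply: (@leq_trans (\sum_(p in MF) \prod_i #|X p i|)); last first.
  rewrite -[leqRHS]sum1_card.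
  rewrite (partition_big (fun c : {ffun I -> {ffun V -> T}} => [ffun i => c i u]) predT) //=.
  rewrite big_mkcond; apply: leq_sum => p _; case: ifP => // _.
  apply: leq_trans (XC p) _; rewrite -sum1_card; apply: eq_leq; apply: eq_bigl => c.
  by rewrite inE.
have count := cross_count k1 Ik (LAk u) (LAk w) N'N (disLA u) N'P.
rewrite expnMn; apply: leq_trans (leq_mul count (leqnn _)) _.
rewrite big_distrl; apply: leq_sum => p /familyP pL /=.
rewrite -prod_nat_const -big_split; apply: leq_prod => i _ /=.
rewrite -sum_nat_const.
rewrite -[leqRHS]sum1_card (partition_big (fun g : {ffun V -> T} => g w) predT) //=.
rewrite big_mkcond; apply: leq_sum => q _; case: ifP => // qS.
have [qL qN] := setDP qS.
(* A colour common to both lists at i lies in [N' i], so the noncrossing condition already keeps q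
   away from [p i]. *)
have pq : p i != q.
  apply: contraNneq qN => pE; rewrite inE -pE imset_f // andbT.
  by apply: N'same; [exact: pL | rewrite pE].
apply: leq_trans (card_sdr_fix2 uw (pL i) qL pq (fun v => LAk v i)) _.
rewrite -sum1_card; apply: eq_leq; apply: eq_bigl => g.
move: qS; rewrite !inE => qS; case: (eqVneq (g w) q) => [->|_]; last by rewrite !andbF.
by rewrite qS !andbT.
Qed.

End Product.

(** * Colourability below the threshold *)

Lemma colorable_lt (V I J T : finType) (v0 : V) (i0 : I)
    (LA : V -> I -> {set T}) (LB : V -> J -> {set T}) :
    (forall v i, #|LA v i| = #|V|.-1 + #|I|) ->
    (forall v j, #|LB v j| = #|V|.-1 + #|I|) ->
    #|J| < ((#|V|.-1 + #|I|) ^_ #|V|) ^ #|I| ->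
  biclique_colorable LA LB.
Proof.
move=> LAk LBk JP; set k := _ + _ in LAk LBk JP.
have [t0 _] : exists x, x \in LA v0 i0.
  by apply/card_gt0P; rewrite LAk addn_gt0; apply/orP; right; apply/card_gt0P; exists i0.
have [/existsP[v /existsP[i /existsP[i' /andP[ii' ndis]]]]|ndis] :=
    boolP [exists v, exists i, exists i', (i != i') && ~~ [disjoint LA v i & LA v i']].
  exact: (colorable_of_overlap v0 i0 LAk LBk ii' ndis).
have disLA v i i' : i != i' -> [disjoint LA v i & LA v i'].
  move=> ii'; apply: contraNT ndis => ndis; apply/existsP; exists v.
  by apply/existsP; exists i; apply/existsP; exists i'; rewrite ii'.
(* With a single vertex there is no pair u, w; then B is empty and all colourings of the I side can
   be kept. *)
have [V1|] := leqP #|V| 1.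
  have {}V1 : #|V| = 1 by apply/eqP; rewrite eqn_leq V1; apply/card_gt0P; exists v0.
  pose CC := [set c : {ffun I -> {ffun V -> T}} | [forall i, sdrb (LA^~ i) (c i)]].
  have CCL c : c \in CC -> forall i, sdr (LA^~ i) (c i).
    by rewrite inE => /forallP cL i; exact/sdrbP.
  apply: (colorable_of_kills_inj v0 i0 LBk CCL).
    by move=> j c c' /CCL cL /CCL c'L; exact: (kills_inj_card1 LBk disLA V1 cL c'L).
  apply: leq_trans JP _.
  apply: (@leq_trans #|family (fun i => mem [set g | sdrb (LA^~ i) g])|); last first.
    apply/subset_leq_card/subsetP => c /familyP cL; rewrite inE.
    by apply/forallP => i; have := cL i; rewrite [_ \in _]inE.
  rewrite card_family_prod -prod_nat_const; apply: leq_prod => i _.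
  exact: (card_sdr t0 (fun v => LAk v i)).
move/card_gt1P=> [u [w [_ _ uw]]].
pose cross i z := (z \in LA w i) && [exists i', (i' != i) && (z \in LA u i')].
pose N' i := if [pick z | cross i z] is Some z then LA w i :\ z else LA w i.
have N'N i : N' i \subset LA w i.
  by rewrite /N'; case: pickP => // z _; exact: subD1set.
have exempt i : {in LA w i :\: N' i &, forall x y, x = y}.
  rewrite /N'; case: pickP => [z _|_] x y; last by rewrite setDv inE.
  move=> /setDP[xw xz] /setDP[yw yz]; move: xz yz.
  by rewrite !inE xw yw !andbT !negbK => /eqP-> /eqP->.
have N'P i : #|N' i| < k \/ (forall i', i' != i -> [disjoint N' i & LA u i']).
  rewrite /N'; case: pickP => [z /andP[zw _]|nocross]; [left|right] => [|i' i'i].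
    by have := LAk w i; rewrite (cardsD1 z) zw => <-.
  apply/pred0P => z /=; apply/negP => /andP[zw zu]; have := nocross z.
  by rewrite /cross zw /= => /existsPn/(_ i'); rewrite i'i zu.
(* The exempt colour lies in a list of u at another index, hence not in [LA u i]. *)
have N'same i x : x \in LA u i -> x \in LA w i -> x \in N' i.
  move=> xu xw; rewrite /N'; case: pickP => // z /andP[_ /existsP[i' /andP[i'i zu]]].
  rewrite !inE xw andbT; apply: contraNneq i'i => xz.
  by rewrite (LA_index disLA (i := i') (i' := i) zu) // -xz.
have := card_noncrossing i0 LAk disLA uw N'N N'P N'same.
set CC := [set c | _] => countCC.
have CCP c : c \in CC -> (forall i, sdr (LA^~ i) (c i)) /\
    (forall i, c i w \notin N' i :&: used (fun i => c i) u).
  rewrite inE => /andP[/forallP cL /forallP cN]; split=> // i; exact/sdrbP.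
apply: (colorable_of_kills_inj v0 i0 LBk (CC := CC)) => [c /CCP[]//|j c c'|].
  move=> /CCP[cL cN] /CCP[c'L c'N].
  exact: (kills_inj_cross LBk disLA exempt cL c'L cN c'N).
exact: leq_trans JP countCC.
Qed.

(** * Choosability: finite palettes and monotonicity *)

Section ListChromaticNumber.
Local Open Scope fset_scope.

(** The union of all lists serves as a finite palette. *)
Lemma choosable_finType (G : sgraph) k :
  (forall (T : finType) (L : G -> {set T}), (forall v, #|L v| = k) ->
     exists f : G -> T, (forall v, f v \in L v) /\ proper_coloring f) ->
  choosable G k.
Proof.
move=> fin C L Lk.
pose U := \bigcup_(v <- fintype.enum G) L v.
have LU v : L v `<=` U by apply: bigfcup_sup => //; rewrite mem_enum.
have [v|f [fL f_proper]] := fin _ (fun v => fsub U (L v)).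
  by rewrite card_fsub.
exists (fun v => fsval (f v)); split=> [v|u v uv].
  by have := fL v; rewrite inE.
by rewrite (inj_eq val_inj); exact: f_proper.
Qed.

Lemma choosable_S (G : sgraph) k : choosable G k -> choosable G k.+1.
Proof.
move=> Gk C L Lk.
have L0 v : exists x, x \in L v by apply/fset0Pn; rewrite -cardfs_gt0 Lk.
pose x v := xchoose (L0 v).
have xL v : x v \in L v by exact: xchooseP.
have [v|f [fL f_proper]] := Gk C (fun v => L v `\ x v).
  by have := Lk v; rewrite (cardfsD1 (x v)) xL => -[].
by exists f; split=> // v; have /fsetD1P[] := fL v.
Qed.

Lemma choosable_leq (G : sgraph) k m : k <= m -> choosable G k -> choosable G m.
Proof.
move=> km Gk; rewrite -(subnK km).
by elim: (m - k) => //= d; exact: choosable_S.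
Qed.

Lemma list_chromatic_number_leq (G : sgraph) k :
  (list_chromatic_number G <= k) <-> choosable G k.
Proof.
rewrite /list_chromatic_number; case: ex_minnP => m /asboolP Gm m_min.
split=> [mk|Gk]; first exact: choosable_leq mk Gm.
by apply: m_min; apply/asboolP.
Qed.

End ListChromaticNumber.

Lemma choosable_set (G : sgraph) k (T : finType) (L : G -> {set T}) :
    choosable G k -> (forall v, #|L v| = k) ->
  exists f : G -> T, (forall v, f v \in L v) /\ proper_coloring f.
Proof.
move=> Gk Lk; have [v|f [fL f_proper]] := Gk T (fun v => [fset x in L v]%fset).
  by rewrite card_finset.
by exists f; split=> // v; have := fL v; rewrite in_fset.
Qed.

Lemma list_chromatic_number_complete n :
  list_chromatic_number (complete_graph n) = n.
Proof.
apply/eqP; rewrite eqn_leq; apply/andP; split.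
  by apply/list_chromatic_number_leq; have := @choosable_card (complete_graph n); rewrite card_ord.
case: n => // n; rewrite ltnNge; apply/negP => /list_chromatic_number_leq Kn.
have [_|f [_ f_proper]] := choosable_set (L := fun=> [set: 'I_n]) Kn.
  by rewrite cardsT card_ord.
suff /leq_card : injective f by rewrite !card_ord ltnn.
by move=> u v fE; apply/eqP/negPn/negP => /f_proper; rewrite fE eqxx.
Qed.

(** * The threshold for the product graph *)

Section ProductWithBiclique.
Variables n a b : nat.
Hypotheses (n_gt0 : 0 < n) (a_gt0 : 0 < a).

Let G := cart_prod (complete_graph n) (complete_bipartite a b).

Lemma product_colorable (T : finType) (L : G -> {set T}) :
    biclique_colorable (fun v (i : 'I_a) => L (v, inl i)) (fun v (j : 'I_b) => L (v, inr j)) ->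
  exists f : G -> T, (forall v, f v \in L v) /\ proper_coloring f.
Proof.
move=> [c [d [cL dL cd]]].
exists (fun p => match p.2 with inl i => c i p.1 | inr j => d j p.1 end).
split=> [[v [i|j]]|[v x] [v' y]] /=; first by have [] := cL i.
  by have [] := dL j.
rewrite /adj /= /cart_adj /= => /orP[/andP[/eqP->]|/andP[/eqP-> {x}]].
  by case: x => [i|j]; case: y => [i'|j'] //= _; rewrite ?cd // eq_sym cd.
rewrite /adj /= /complete_adj.
case: y => [i|j] vv'; first by have [_ /inj_eq->] := cL i.
by have [_ /inj_eq->] := dL j.
Qed.

Lemma product_choosable_add : choosable G (n + a).
Proof.
apply: choosable_finType => T L Lk; apply: product_colorable.
by apply: (colorable_big (Ordinal n_gt0) (Ordinal a_gt0) (k := n + a)); rewrite ?card_ord.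
Qed.

Lemma product_choosable_lt : b < ((n.-1 + a) ^_ n) ^ a -> choosable G (n.-1 + a).
Proof.
move=> b_lt; apply: choosable_finType => T L Lk; apply: product_colorable.
by apply: (colorable_lt (Ordinal n_gt0) (Ordinal a_gt0)); rewrite ?card_ord.
Qed.

(* Disjoint palettes on the [a] side; each tuple of colourings of that side is
   blocked by one copy, whose lists add a common set of [n - 1] new colours. *)
Lemma product_not_choosable : ((n.-1 + a) ^_ n) ^ a <= b -> ~ choosable G (n.-1 + a).
Proof.
set k := n.-1 + a => b_ge Gk.
have k_gt0 : 0 < k by rewrite /k addn_gt0 a_gt0 orbT.
pose x0 : 'I_k := Ordinal k_gt0.
pose D := [set c : {ffun 'I_a -> {ffun 'I_n -> 'I_k}} | [forall i, injectiveb (c i)]].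
have cardD : #|D| = (k ^_ n) ^ a.
  have -> : #|D| = #|family (fun i : 'I_a => mem [set g : {ffun 'I_n -> 'I_k} | injectiveb g])|.
    apply: eq_card => c; rewrite inE; apply/forallP/familyP => c_inj i.
      by rewrite [_ \in _]inE.
    by have := c_inj i; rewrite [_ \in _]inE.
  by rewrite (card_family_const (k := k ^_ n)) ?card_ord // => i; rewrite card_inj_ffuns !card_ord.
pose h (j : 'I_b) := nth [ffun=> [ffun=> x0]] (enum D) j.
have hP c : c \in D -> exists j, h j = c.
  move=> cD; have lt_cb : index c (enum D) < b.
    by apply: leq_trans b_ge; rewrite -cardD cardE index_mem mem_enum.
  by exists (Ordinal lt_cb); rewrite /h nth_index // mem_enum.
pose T : finType := ('I_a * 'I_k + 'I_n.-1)%type.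
pose L (p : G) : {set T} := match p.2 with
  | inl i => [set inl (i, x) | x in 'I_k]
  | inr j => [set inl (i, h j i p.1) | i in 'I_a] :|: [set inr y | y in 'I_n.-1]
  end.
have [[v [i|j]]|f [fL f_proper]] := choosable_set (L := L) Gk.
- by rewrite card_imset ?card_ord // => x y [].
- rewrite /L /= cardsU (_ : _ :&: _ = set0) ?cards0 ?subn0.
    by rewrite !card_imset ?card_ord 1?addnC // => [x y []|x y []].
  by apply/setP => x; rewrite !inE; apply/negP => /andP[/imsetP[i _ ->] /imsetP[]].
pose g i v : 'I_k := if f (v, inl i) is inl p then p.2 else x0.
have fE i v : f (v, inl i) = inl (i, g i v).
  by rewrite /g; have := fL (v, inl i) => /imsetP[x _ ->].
have adjV v v' x : v != v' -> f (v, x) != f (v', x).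
  by move=> vv'; apply: f_proper; apply/orP; right; rewrite /= eqxx.
have gD : [ffun i => [ffun v => g i v]] \in D.
  rewrite inE; apply/forallP => i; apply/injectiveP => v v'; rewrite !ffunE => gE.
  by apply/eqP/negPn/negP => /(adjV _ _ (inl i)); rewrite !fE gE eqxx.
have [j hj] := hP _ gD.
have y_ex v : exists y : 'I_n.-1, f (v, inr j) = inr y.
  have /setUP[/imsetP[i _ fjE]|/imsetP[y _ ->]] := fL (v, inr j); last by exists y.
  have : f (v, inl i) != f (v, inr j).
    by apply: f_proper; rewrite /adj /= /cart_adj /= eqxx.
  by rewrite fE fjE hj !ffunE eqxx.
have [y yE] := fin_all_exists y_ex.
suff /leq_card : injective y by rewrite !card_ord leqNgt prednK ?leqnn.
move=> v v' yv; apply/eqP/negPn/negP => /(adjV _ _ (inr j)).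
by rewrite !yE yv eqxx.
Qed.

Lemma list_chromatic_number_product :
  list_chromatic_number G = n + a <-> ((n.-1 + a) ^_ n) ^ a <= b.
Proof.
have naE : n + a = (n.-1 + a).+1 by rewrite -addSn prednK.
have := product_choosable_add => /list_chromatic_number_leq le_na.
split=> [GE|b_ge].
  rewrite leqNgt; apply/negP => /product_choosable_lt/list_chromatic_number_leq.
  by rewrite GE naE ltnn.
apply/eqP; rewrite eqn_leq le_na naE ltnNge; apply/negP.
by move/list_chromatic_number_leq; exact: product_not_choosable.
Qed.

End ProductWithBiclique.

Theorem theorem8 (n a : nat) (n_gt0 : 0 < n) (a_gt0 : 0 < a) :
  (forall b : nat, 0 < b ->
     (list_chromatic_number (cart_prod (complete_graph n) (complete_bipartite a b)) = n + a
      <-> ((n + a - 1)`! %/ (a - 1)`!) ^ a <= b))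
  /\ f_list a (complete_graph n) = ((n + a - 1)`! %/ (a - 1)`!) ^ a.
Proof.
(* With k = n + a - 1 this is k!/(k - n)!, as k - n = a - 1. *)
have PE : (n + a - 1)`! %/ (a - 1)`! = (n.-1 + a) ^_ n.
  have -> : n + a - 1 = n.-1 + a by lia.
  by rewrite ffact_factd; [congr (_ %/ _`!) |]; lia.
(* This supplies the positivity of b demanded by [attains_max]. *)
have P_gt0 : 0 < ((n.-1 + a) ^_ n) ^ a by rewrite expn_gt0 ffact_gt0; lia.
rewrite PE; split=> [b _|]; first exact: list_chromatic_number_product.
have attainsE b : attains_max (complete_graph n) a b = (((n.-1 + a) ^_ n) ^ a <= b).
  rewrite /attains_max list_chromatic_number_complete.
  apply/andP/idP => [[_ /eqP]|b_ge]; first by move/list_chromatic_number_product; exact.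
  by rewrite (leq_trans P_gt0) //; split=> //; apply/eqP/list_chromatic_number_product.
rewrite /f_list; case: pselect => [ex_b|[]]; last first.
  by exists (((n.-1 + a) ^_ n) ^ a); rewrite attainsE.
case: ex_minnP => m; rewrite attainsE => Pm m_min.
by apply/eqP; rewrite eqn_leq Pm m_min // attainsE.
Qed.
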